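(* Let $m,n,s,k,t$ be positive integers and let $A$ be an $\mathrm{H}_t(m,n;s,k)$ that is simple with respect to the orderings $\omega_r$ (for the rows) and $\omega_c$ (for the columns). Then: (1) there exists a cyclic $s$-cycle decomposition $\mathcal{D}_{\omega_r}$ of $K_{\frac{2ms+t}{t}\times t}$; (2) there exists a cyclic $k$-cycle decomposition $\mathcal{D}_{\omega_c}$ of $K_{\frac{2nk+t}{t}\times t}$; (3) the cycle decompositions $\mathcal{D}_{\omega_r}$ and $\mathcal{D}_{\omega_c}$ are orthogonal. (Here $2ms+t=2nk+t$, so both are decompositions of the same graph, with vertex set $\mathbb{Z}_{2nk+t}$.)
   Context: A partially filled (p.f.) $m\times n$ array is an $m\times n$ matrix in which some cells are allowed to be empty. Let $v=2nk+t$ with $t$ dividing $2nk$, and let $J$ be the subgroup of $\mathbb{Z}_v$ of order $t$. An $\mathrm{H}_t(m,n;s,k)$ (Heffter array over $\mathbb{Z}_v$ relative to $J$) is an $m\times n$ p.f. array with elements in $\mathbb{Z}_v$ such that: each row contains exactly $s$ filled cells and each column contains exactly $k$ filled cells (so $ms=nk$); for every $x\in\mathbb{Z}_v\setminus J$, either $x$ or $-x$ appears in the array; the elements in every row and every column sum to $0$ in $\mathbb{Z}_v$. An ordering $(t_1,\ldots,t_\ell)$ of a finite subset of an abelian group is simple if the partial sums $s_i=\sum_{j=1}^i t_j$, $i=1,\ldots,\ell$, are pairwise distinct. The array is simple with respect to $\omega_r$ and $\omega_c$ if $\omega_r$ consists of a simple ordering of the elements of each row and $\omega_c$ consists of a simple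 ordering of the elements of each column. $\mathcal{D}_{\omega_r}$ is the set of all translates by elements of $\mathbb{Z}_v$ of the $m$ $s$-cycles whose consecutive vertices are the partial sums of the row orderings in $\omega_r$; $\mathcal{D}_{\omega_c}$ is obtained likewise from the $n$ column orderings in $\omega_c$, giving $k$-cycles. $K_{q\times r}$ is the complete multipartite graph with $q$ parts each of size $r$; here its vertex set is $\mathbb{Z}_v$ and its parts are the cosets of $J$. An $\ell$-cycle decomposition of a graph $K$ is a set of subgraphs of $K$, each a cycle of length $\ell$, whose edge sets partition $E(K)$. It is cyclic if it admits a cyclic group of automorphisms (bijections of $V(K)$ leaving the decomposition invariant) acting sharply transitively on $V(K)$. Two cycle decompositions $\mathcal{D},\mathcal{D}'$ of the same graph are orthogonal if every $B\in\mathcal{D}$ and every $B'\in\mathcal{D}'$ have at most one edge in common. *)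

(* Defs.v *)
From mathcomp Require Import all_boot all_order all_algebra all_fingroup all_solvable.
Set Implicit Arguments. Unset Strict Implicit. Unset Printing Implicit Defensive.
Import GRing.Theory.
Local Open Scope ring_scope.

(* A graph on vertices taken from V is a pair (vertex set, edge set); an edge is
   the set of its two endpoints. *)
Notation graph V := ({set V} * {set {set V}})%type (only parsing).

Definition vertices (V : finType) (G : graph V) : {set V} := G.1.
Definition edges (V : finType) (G : graph V) : {set {set V}} := G.2.

Definition subgraph (V : finType) (G K : graph V) : bool :=
  (vertices G \subset vertices K) && (edges G \subset edges K).

Definition map_graph (V W : finType) (f : V -> W) (G : graph V) : graph W :=
  (f @: vertices G, [set f @: e | e : {set V} in edges G]).

(* [next c x] is the successor of x in c, the last item being followed by the
   first one. *)
Definition cycle_graph (V : finType) (c : seq V) : graph V :=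
  ([set x in c], [set [set x; next c x] | x in c]).

Definition is_cycle (V : finType) (l : nat) (G : graph V) : Prop :=
  exists c : seq V, [/\ (3 <= l)%N, uniq c, size c = l & G = cycle_graph c].

Definition multipartite_graph (V : finType) (P : {set {set V}}) : graph V :=
  (cover P,
   [set [set x; y] | x in cover P, y in cover P & pblock P x != pblock P y]).

Definition is_complete_multipartite (V : finType) (q r : nat) (K : graph V) :
    Prop :=
  exists P : {set {set V}},
    [/\ partition P (vertices K), #|P| = q,
        forall B : {set V}, B \in P -> #|B| = r & K = multipartite_graph P].

Definition cycle_decomposition (V : finType) (l : nat) (K : graph V)
    (D : {set graph V}) : Prop :=
  [/\ forall B, B \in D -> is_cycle l B /\ subgraph B K,
      {in D &, forall B B', B != B' -> [disjoint edges B & edges B']}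
    & \bigcup_(B in D) edges B = edges K].

(* [perm_on S g] holds when g fixes every point outside S, i.e. when g is a
   bijection of S. *)
Definition cyclic_decomposition (V : finType) (K : graph V)
    (D : {set graph V}) : Prop :=
  exists G : {group {perm V}},
    [/\ cyclic G,
        forall g : {perm V}, g \in G -> perm_on (vertices K) g,
        forall g : {perm V}, g \in G -> [set map_graph g B | B in D] = D
      & {in vertices K &, forall x y, exists! g : {perm V}, g \in G /\ g x = y}].

Definition orthogonal_decompositions (V : finType) (D D' : {set graph V}) :
    Prop :=
  forall B B', B \in D -> B' \in D' -> (#|edges B :&: edges B'| <= 1)%N.

(* A partially filled array is a matrix with entries in an option type, [None]
   standing for an empty cell. *)
Definition row_elems (T : Type) (m n : nat) (A : 'M[option T]_(m, n))
    (i : 'I_m) : seq T := pmap (fun j => A i j) (enum 'I_n).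

Definition col_elems (T : Type) (m n : nat) (A : 'M[option T]_(m, n))
    (j : 'I_n) : seq T := pmap (fun i => A i j) (enum 'I_m).

Record relative_heffter (v m n s k : nat) (J : {set 'Z_v})
    (A : 'M[option 'Z_v]_(m, n)) : Prop := RelativeHeffter {
  heffter_row_size : forall i, size (row_elems A i) = s;
  heffter_col_size : forall j, size (col_elems A j) = k;
  heffter_cover : forall x : 'Z_v, x \notin J ->
    exists i j, A i j = Some x \/ A i j = Some (- x);
  heffter_row_sum : forall i, \sum_(x <- row_elems A i) x = 0;
  heffter_col_sum : forall j, \sum_(x <- col_elems A j) x = 0
}.

Definition partial_sums (M : zmodType) (w : seq M) : seq M := scanl +%R 0 w.

Definition simple_ordering (M : zmodType) (w : seq M) : bool :=
  uniq (partial_sums w).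

Definition simple_wrt (v m n : nat) (A : 'M[option 'Z_v]_(m, n))
    (wr : 'I_m -> seq 'Z_v) (wc : 'I_n -> seq 'Z_v) : Prop :=
  (forall i, perm_eq (wr i) (row_elems A i) /\ simple_ordering (wr i)) /\
  (forall j, perm_eq (wc j) (col_elems A j) /\ simple_ordering (wc j)).

Definition cycle_translates (v p : nat) (w : 'I_p -> seq 'Z_v) :
    {set graph 'Z_v} :=
  [set map_graph (fun y => y + x) (cycle_graph (partial_sums (w i)))
     | i : 'I_p, x : 'Z_v].

(* The group law of 'Z_v as a finite group is its addition, so the blocks are
   the additive cosets of J. *)
Definition coset_graph (v : nat) (J : {set 'Z_v}) : graph 'Z_v :=
  multipartite_graph (rcosets J [set: 'Z_v]).

(* Main.v *)
(* Counting shows that the n k entries of the array are distinct and that, up to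
   sign, each element outside J occurs exactly once.  The differences of
   consecutive vertices of the cycle of partial sums of a row are the entries of
   that row, so an edge {a, b} with b - a outside J lies on exactly one
   translate of exactly one row cycle: the one determined by the entry equal to
   b - a or a - b.  A common edge of a row translate and a column translate has
   as its difference the unique entry in the cell where row and column meet,
   and a translate contains only one edge with a given difference. *)
Require Import Defs.
From mathcomp Require Import all_boot all_order all_algebra all_fingroup all_solvable.
From mathcomp Require Import zify.
Set Implicit Arguments. Unset Strict Implicit. Unset Printing Implicit Defensive.
Import GRing.Theory.
Local Open Scope ring_scope.

(** * Finite sets and sequences: unordered pairs, injectivity, tight covers *)

Lemma set2_inj (T : finType) (a b c d : T) :
  [set a; b] = [set c; d] -> (a = c /\ b = d) \/ (a = d /\ b = c).
Proof.
move=> /setP E; move: (E a) (E b) (E c) (E d); rewrite !inE !eqxx ?orbT /=.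
by do 4 case: eqP => //= ?; do ?case: eqP => //= ?; intros; subst; auto.
Qed.

Lemma map_uniq_inj_in (T1 T2 : eqType) (f : T1 -> T2) (s : seq T1) :
  uniq (map f s) -> {in s &, injective f}.
Proof.
elim: s => //= x s IHs /andP[fxs /IHs inj] y z; rewrite !inE.
case/predU1P=> [->|ys] /predU1P[->|zs] // E; last exact: inj.
- by case/negP: fxs; rewrite E map_f.
- by case/negP: fxs; rewrite -E map_f.
Qed.

(** Since [b.*2 <= #|X| <= #|S :|: f @: S| <= #|S|.*2 <= b.*2], every inequality is an equality: [S]
    and its image are disjoint and their union is exactly [X]. *)
Lemma tight_image_cover (T : finType) (f : T -> T) (S X : {set T}) (b : nat) :
    injective f -> (#|S| <= b)%N -> (b.*2 <= #|X|)%N -> X \subset S :|: f @: S ->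
  [/\ #|S| = b, S :&: f @: S = set0 & S \subset X].
Proof.
move=> inj_f leS leX cov; have leC := subset_leq_card cov.
have UI := cardsUI S (f @: S); rewrite card_imset // in UI.
have [cS cI cU] : [/\ #|S| = b, #|S :&: f @: S| = 0%N
                    & (#|S :|: f @: S| <= #|X|)%N] by split; lia.
split=> //; first exact: cards0_eq.
have /eqP-> : X == S :|: f @: S by rewrite eqEcard cov cU.
exact: subsetUl.
Qed.

Lemma subrDr (M : zmodType) (z x y : M) : (x + z) - (y + z) = x - y.
Proof. by rewrite opprD addrACA subrr addr0. Qed.

(** * Cycles of partial sums, their translates, and the coset graph *)

Section Translates.

Variables (v : nat).
Implicit Types (w : seq 'Z_v) (x y : 'Z_v) (J : {group 'Z_v}).

(** [partial_sums] starts at the first entry and not at 0, so the first difference is the second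
    entry, whence the rotation. The zero sum makes the last vertex 0, and the closing edge then
    yields the first entry. *)
Lemma partial_sums_diff w :
    uniq (partial_sums w) -> \sum_(x <- w) x = 0 ->
  [seq next (partial_sums w) x - x | x <- partial_sums w] = seq.rot 1 w.
Proof.
case: w => [//|a w]; rewrite /partial_sums [scanl _ _ _]/= add0r rot1_cons.
move=> Uc w0.
have c_size : size (a :: scanl +%R a w) = (size w).+1 by rewrite /= size_scanl.
apply: (@eq_from_nth _ 0) => [|i]; first by rewrite size_map c_size size_rcons.
rewrite size_map c_size => ltiw.
rewrite (nth_map 0) ?c_size // next_nth mem_nth ?c_size // index_uniq ?c_size //.
rewrite nth_rcons; move: ltiw; rewrite ltnS leq_eqVlt.
(* At the last index, [nth] in [next_nth] runs past the end and returns its default, the head [a]: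
   this is the wrap-around. *)
case/predU1P=> [->|ltiw].
  rewrite ltnn eqxx nth_default ?size_scanl // nth_cons_scanl // take_size.
  by rewrite foldlE w0 subr0.
rewrite ltiw.
have addK : forall z : 'Z_v, cancel (+%R z) (fun t => t - z).
  by move=> z t; rewrite addrC addKr.
rewrite -[in RHS](scanlK (f := fun z t => t - z) addK a w).
by rewrite (nth_pairmap 0) ?size_scanl //; congr (_ - _); apply: set_nth_default;
  rewrite size_scanl.
Qed.

Lemma mem_edges_block w x (e : {set 'Z_v}) :
  reflect (exists2 y, y \in partial_sums w
                      & e = [set y + x; next (partial_sums w) y + x])
          (e \in edges (map_graph (fun y => y + x)
                          (cycle_graph (partial_sums w)))).
Proof.
apply: (iffP imsetP) => [[_ /imsetP[y yc ->] ->]|[y yc ->]].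
  by exists y => //; rewrite imsetU1 imset_set1.
exists [set y; next (partial_sums w) y]; last by rewrite imsetU1 imset_set1.
by apply: imset_f.
Qed.

Lemma map_cycle_graph (V W : finType) (f : V -> W) (c : seq V) :
  injective f -> uniq c -> map_graph f (cycle_graph c) = cycle_graph (map f c).
Proof.
move=> inj_f Uc; congr (_, _); apply/setP=> e.
  rewrite inE; apply/imsetP/mapP => -[x xc ->]; exists x => //.
    by rewrite inE in xc.
  by rewrite inE.
apply/imsetP/imsetP=> [[_ /imsetP[x xc ->] ->]|[_ /mapP[x xc ->] ->]].
  exists (f x); first exact: map_f.
  by rewrite imsetU1 imset_set1 next_map.
exists [set x; next c x]; first by apply: imset_f.
by rewrite imsetU1 imset_set1 next_map.
Qed.

Lemma cover_rcosets J : cover (rcosets J [set: 'Z_v]) = [set: 'Z_v].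
Proof. by case/and3P: (rcosets_partition (subsetT J)) => /eqP. Qed.

Lemma mem_edges_coset_graph J (e : {set 'Z_v}) :
  reflect (exists x y, e = [set x; y] /\ y - x \notin J)
          (e \in edges (coset_graph J)).
Proof.
have pblockE (z : 'Z_v) : pblock (rcosets J [set: 'Z_v]) z = (J :* z)%g.
  case/and3P: (rcosets_partition (subsetT J)) => _ tI _.
  apply: def_pblock => //; last exact: rcoset_refl.
  by apply/rcosetsP; exists z; rewrite ?inE.
have pblock_neq (x y : 'Z_v) :
    (pblock (rcosets J [set: 'Z_v]) x != pblock (rcosets J [set: 'Z_v]) y)
    = (y - x \notin J).
  rewrite !pblockE; congr (~~ _); rewrite eq_sym.
  by apply/eqP/idP => [/rcoset_eqP|yx]; [|apply/rcoset_eqP]; rewrite mem_rcoset.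
apply: (iffP imset2P) => [[x y _]|[x [y [-> yx]]]].
  rewrite inE pblock_neq => /andP[_ yx] ->; by exists x, y.
by exists x y; rewrite ?inE ?pblock_neq ?cover_rcosets ?inE.
Qed.

Lemma coset_graph_complete J : (1 < v)%N ->
  is_complete_multipartite (v %/ #|J|)%N #|J| (coset_graph J).
Proof.
move=> v_gt1; exists (rcosets J [set: 'Z_v]); split=> // [||B].
- by rewrite /vertices /= cover_rcosets rcosets_partition ?subsetT.
- by rewrite -[LHS]/(#|[set: 'Z_v] : J|%g) -divgS ?subsetT // cardsT card_ord Zp_cast.
- by case/rcosetsP=> x _ ->; rewrite card_rcoset.
Qed.

(** The powers of [y |-> y + 1] are all the translations. They only change the shift of a block, and
    adding [y - x] is the only one taking [x] to [y]. *)
Lemma cycle_translates_cyclic p (w : 'I_p -> seq 'Z_v) J :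
  cyclic_decomposition (coset_graph J) (cycle_translates w).
Proof.
pose g := perm (addIr (1 : 'Z_v)).
have gX (j : nat) (y : 'Z_v) : (g ^+ j)%g y = y + j%:R.
  elim: j y => [|j IHj] y; first by rewrite expg0 perm1 addr0.
  by rewrite expgSr permM IHj permE -addrA natr1.
have map_gX (j : nat) (x : 'Z_v) (B : graph 'Z_v) :
    map_graph (g ^+ j)%g (map_graph (fun y => y + x) B)
    = map_graph (fun y => y + (x + j%:R)) B.
  have E : (g ^+ j)%g \o (fun y => y + x) =1 (fun y => y + (x + j%:R)).
    by move=> y; rewrite /= gX addrA.
  congr (_, _); first by rewrite /= -imset_comp; apply: eq_imset.
  rewrite /= -imset_comp; apply: eq_imset => e /=.
  by rewrite -imset_comp; apply: eq_imset.
exists <[g]>%G; split.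
- exact: cycle_cyclic.
- by move=> h _; rewrite /vertices /= cover_rcosets; apply/subsetP=> x; rewrite inE.
- move=> _ /cycleP[j ->]; apply/setP=> B; apply/imsetP/imset2P.
    case=> _ /imset2P[i x _ _ ->] ->; exists i (x + j%:R) => //; exact: map_gX.
  case=> i x _ _ ->.
  exists (map_graph (fun y => y + (x - j%:R)) (cycle_graph (partial_sums (w i)))).
    exact: imset2_f.
  by rewrite map_gX subrK.
- move=> x y _ _; exists (g ^+ (y - x)%R)%g; split.
    by rewrite mem_cycle gX natr_Zp addrC subrK.
  move=> _ [/cycleP[j ->] <-]; apply/permP=> z.
  by rewrite !gX natr_Zp addrAC subrr add0r.
Qed.

(* Together these say that of each pair [{x, -x}] outside [J] exactly one element
   occurs, in exactly one [w i], and that it differs from its opposite. *)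
Record difference_family p l (J : {set 'Z_v}) (w : 'I_p -> seq 'Z_v) : Prop :=
  DifferenceFamily {
  df_size : forall i, size (w i) = l;
  df_sum : forall i, \sum_(x <- w i) x = 0;
  df_simple : forall i, simple_ordering (w i);
  df_uniq : forall i, uniq (w i);
  df_disjoint : forall i i' x, x \in w i -> x \in w i' -> i = i';
  df_opp : forall i i' x, x \in w i -> - x \notin w i';
  df_notin : forall i x, x \in w i -> x \notin J;
  df_cover : forall x, x \notin J -> exists i, x \in w i \/ - x \in w i
}.

(** * From difference families to cycle decompositions *)

Section Family.

Variables (p l : nat) (J : {group 'Z_v}) (w : 'I_p -> seq 'Z_v).
Hypothesis dfw : difference_family l J w.

Let c i := partial_sums (w i).
Let d i y := next (c i) y - y.

Lemma df_diff_mem i y : y \in c i -> d i y \in w i.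
Proof.
move=> yc; rewrite -(mem_rot 1) -partial_sums_diff ?(df_sum dfw) //.
  exact: (map_f (d i)).
exact: (df_simple dfw).
Qed.

(** The differences along the cycle form a rotation of [w i], which has no repetition. *)
Lemma df_diff_inj i : {in c i &, injective (d i)}.
Proof.
apply: map_uniq_inj_in; rewrite partial_sums_diff ?(df_sum dfw) //.
  by rewrite seq.rot_uniq (df_uniq dfw).
exact: (df_simple dfw).
Qed.

Lemma df_diff_surj i x : x \in w i -> exists2 y, y \in c i & d i y = x.
Proof.
rewrite -(mem_rot 1) -partial_sums_diff ?(df_sum dfw) //.
  by case/mapP=> y yc ->; exists y.
exact: (df_simple dfw).
Qed.

(** A single entry with zero sum would be 0, which lies in [J]; two entries with zero sum would be
    opposite. *)
Lemma df_size_ge3 (i : 'I_p) : (0 < l)%N -> (3 <= l)%N.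
Proof.
move: (df_size dfw i) (df_sum dfw i) => <-.
have := @df_notin _ _ _ _ dfw i; have := @df_opp _ _ _ _ dfw i i.
case: (w i) => [|a [|b [|? ?]]] //= opp_w notJ; rewrite !big_cons big_nil addr0.
  move=> a0 _; have /negP[] := notJ a (mem_head _ _).
  by rewrite a0; exact: (group1 J).
move/eqP; rewrite addrC addr_eq0 => /eqP bE _.
by have := opp_w a (mem_head _ _); rewrite -bE !inE eqxx orbT.
Qed.

(** If the endpoints match in reverse, an entry and its opposite both occur, which is excluded.
    Otherwise the differences agree; their common value determines first the index, then the vertex,
    then the shift. *)
Lemma df_edge_inj i i' x x' y y' : y \in c i -> y' \in c i' ->
    [set y + x; next (c i) y + x] = [set y' + x'; next (c i') y' + x'] ->
  [/\ i = i', y = y' & x = x'].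
Proof.
move=> yc yc' /set2_inj[[E1 E2]|[E1 E2]]; last first.
  have /negP[] := df_opp dfw i' (df_diff_mem yc).
  suff -> : - d i y = d i' y' by apply: df_diff_mem.
  by rewrite /d opprB -(subrDr x) E1 E2 subrDr.
have E : d i y = d i' y'.
  by rewrite /d -(subrDr x) E1 E2 subrDr.
have ii : i = i'.
  by apply: (df_disjoint dfw (df_diff_mem yc)); rewrite E df_diff_mem.
subst i'; have yy : y = y' by apply: df_diff_inj yc yc' E.
by subst y'; split=> //; apply: addrI E1.
Qed.

Lemma df_cycle_decomposition : (0 < l)%N ->
  cycle_decomposition l (coset_graph J) (cycle_translates w).
Proof.
move=> l_gt0; split.
- move=> _ /imset2P[i x _ _ ->]; split.
    exists [seq y + x | y <- c i]; split.
    + exact: df_size_ge3 i l_gt0.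
    + by rewrite (map_inj_uniq (@addIr _ x)); exact: (df_simple dfw).
    + by rewrite size_map size_scanl (df_size dfw).
    + by rewrite map_cycle_graph //; [exact: addIr | exact: (df_simple dfw)].
  apply/andP; split; first by rewrite /vertices /= cover_rcosets subsetT.
  apply/subsetP=> _ /mem_edges_block[y yc ->]; apply/mem_edges_coset_graph.
  exists (y + x), (next (c i) y + x); split=> //.
  by rewrite subrDr (df_notin dfw (df_diff_mem yc)).
- move=> _ _ /imset2P[i x _ _ ->] /imset2P[i' x' _ _ ->].
  apply: contraNT => /pred0Pn[e /andP[/=]].
  case/mem_edges_block=> y yc -> /mem_edges_block[y' yc'].
  by case/(df_edge_inj yc yc') => -> _ ->.
- apply/setP=> e; apply/bigcupP/mem_edges_coset_graph.
    case=> _ /imset2P[i x _ _ ->] /mem_edges_block[y yc ->].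
    exists (y + x), (next (c i) y + x); split=> //.
    by rewrite subrDr (df_notin dfw (df_diff_mem yc)).
  case=> a [b [-> /(df_cover dfw)[i]]].
  (* Swapping the endpoints of the edge negates its difference. *)
  wlog ba : a b / b - a \in w i => [IH|_].
    case=> H; first by apply: (IH a b) => //; left.
    by rewrite opprB in H; rewrite setUC; apply: (IH b a) => //; left.
  have [y yc yd] := df_diff_surj ba.
  (* The shift by [a - y] sends [y] to [a], hence its successor to [a + (b - a) = b]. *)
  exists (map_graph (fun z => z + (a - y)) (cycle_graph (c i))).
    exact: imset2_f.
  apply/mem_edges_block; exists y => //.
  have -> : y + (a - y) = a by rewrite addrC subrK.
  by have -> : next (c i) y + (a - y) = b by rewrite addrCA -/(d i y) yd addrC subrK.
Qed.

End Family.

(** As no opposite of a row entry is a column entry, both cycles traverse a common edge in the same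
    direction. Its difference therefore lies in [wr i] and in [wc j], so it is unique, and it fixes
    the edge by [df_diff_inj]. *)
Lemma df_orthogonal p q l l' J (wr : 'I_p -> seq 'Z_v) (wc : 'I_q -> seq 'Z_v) :
    difference_family l J wr -> difference_family l' J wc ->
    (forall i j x, x \in wr i -> - x \notin wc j) ->
    (forall i j x x', x \in wr i -> x \in wc j -> x' \in wr i -> x' \in wc j ->
       x = x') ->
  orthogonal_decompositions (cycle_translates wr) (cycle_translates wc).
Proof.
move=> dfr dfc opp_rc cap_rc _ _ /imset2P[i x _ _ ->] /imset2P[j x' _ _ ->].
pose cr := partial_sums (wr i); pose cc := partial_sums (wc j).
apply/card_le1_eqP.
have common e : e \in edges (map_graph (fun y => y + x) (cycle_graph cr))
                    :&: edges (map_graph (fun y => y + x') (cycle_graph cc)) ->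
    exists y, [/\ y \in cr, e = [set y + x; next cr y + x]
                & next cr y - y \in wc j].
  case/setIP=> /mem_edges_block[y yc ->] /mem_edges_block[z zc E].
  exists y; split=> //; case/set2_inj: E => -[E1 E2].
    suff -> : next cr y - y = next cc z - z by apply: (df_diff_mem dfc).
    by rewrite -(subrDr x) E1 E2 subrDr.
  have /negP[] := opp_rc i j _ (df_diff_mem dfr yc).
  suff -> : - (next cr y - y) = next cc z - z by apply: (df_diff_mem dfc).
  by rewrite opprB -(subrDr x) E1 E2 subrDr.
move=> e e' /common[y [yc -> yj]] /common[y' [yc' -> yj']].
have -> // : y = y'.
apply: (df_diff_inj dfr yc yc'); apply: (cap_rc i j) => //; exact: (df_diff_mem dfr).
Qed.

End Translates.

(** * Counting the entries of a Heffter array *)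

Section HeffterArrays.

Variables (v m n : nat).
Implicit Types (A : 'M[option 'Z_v]_(m, n)) (J : {set 'Z_v}).

Lemma mem_row_elems A i x :
  reflect (exists j, A i j = Some x) (x \in row_elems A i).
Proof.
rewrite mem_pmap; apply: (iffP mapP) => [[j _ ->]|[j Aij]]; first by exists j.
by exists j; rewrite ?mem_enum ?Aij.
Qed.

Lemma row_elems_tr A j : row_elems A^T j = col_elems A j.
Proof. by apply: eq_pmap => i; rewrite mxE. Qed.

Lemma col_elems_tr A i : col_elems A^T i = row_elems A i.
Proof. by apply: eq_pmap => j; rewrite mxE. Qed.

Lemma mem_col_elems A j x :
  reflect (exists i, A i j = Some x) (x \in col_elems A j).
Proof.
rewrite mem_pmap; apply: (iffP mapP) => [[i _ ->]|[i Aij]]; first by exists i.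
by exists i; rewrite ?mem_enum ?Aij.
Qed.

Definition filled A := [set p : 'I_m * 'I_n | A p.1 p.2].

Lemma card_filled_row A : #|filled A| = (\sum_i size (row_elems A i))%N.
Proof.
rewrite -sum1dep_card.
rewrite -(pair_big_dep predT (fun i j => isSome (A i j)) (fun _ _ => 1%N)).
apply: eq_bigr => i _; rewrite size_pmap -sum1_count big_enum_cond.
exact: eq_bigl.
Qed.

Lemma card_filled_col A : #|filled A| = (\sum_j size (col_elems A j))%N.
Proof.
rewrite card_filled_row.
under eq_bigr do rewrite size_pmap -sum1_count big_enum_cond big_mkcond.
under [RHS]eq_bigr do rewrite size_pmap -sum1_count big_enum_cond big_mkcond.
exact: exchange_big.
Qed.

Lemma heffter_card s k J A :
  relative_heffter s k J A -> (m * s)%N = (n * k)%N.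
Proof.
move=> hA; have := card_filled_row A; rewrite card_filled_col.
under eq_bigr do rewrite (heffter_col_size hA).
under [RHS]eq_bigr do rewrite (heffter_row_size hA).
by rewrite !sum_nat_const !card_ord.
Qed.

(* The [n k] entries and their opposites cover the [2 n k] elements outside [J],
   so equality holds in every intermediate cardinality bound. *)
Lemma heffter_entries s k J A :
    relative_heffter s k J A -> ((n * k).*2 <= #|~: J|)%N ->
  [/\ forall i j i' j' x, A i j = Some x -> A i' j' = Some x -> i = i' /\ j = j',
      forall i j i' j' x, A i j = Some x -> A i' j' <> Some (- x)
    & forall i j x, A i j = Some x -> x \notin J].
Proof.
move=> hA leJ; pose val (p : 'I_m * 'I_n) := odflt 0 (A p.1 p.2).
pose S : {set 'Z_v} := val @: filled A; pose N := [set - x | x in S].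
have memF i j x : A i j = Some x -> (i, j) \in filled A by rewrite inE /= => ->.
have memS i j x : A i j = Some x -> x \in S.
  by move=> Aij; apply/imsetP; exists (i, j); rewrite ?(memF _ _ _ Aij) /val /= ?Aij.
have cardF : #|filled A| = (n * k)%N.
  rewrite card_filled_col; under eq_bigr do rewrite (heffter_col_size hA).
  by rewrite sum_nat_const card_ord.
have leS : (#|S| <= n * k)%N by rewrite -cardF leq_imset_card.
have coverSN : ~: J \subset S :|: N.
  apply/subsetP=> x; rewrite !inE => /(heffter_cover hA)[i [j [/memS->//|Aij]]].
  by apply/orP; right; apply/imsetP; exists (- x); rewrite ?opprK ?(memS _ _ _ Aij).
have [cardS SN0 SJ] := tight_image_cover oppr_inj leS leJ coverSN.
(* Now [val @: filled A] has as many elements as [filled A], so [val] is injective on filled cells: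
   no value occurs twice. *)
rewrite -cardF in cardS; split.
- move=> i j i' j' x Aij Aij'; suff [-> ->] : (i, j) = (i', j') by [].
  apply: (imset_injP (introT eqP cardS)); rewrite ?(memF _ _ _ Aij) ?(memF _ _ _ Aij') //.
  by rewrite /val /= Aij Aij'.
- move=> i j i' j' x Aij Aij'; have /setP/(_ (- x)) := SN0.
  by rewrite !inE (memS _ _ _ Aij') /= imset_f // (memS _ _ _ Aij).
- by move=> i j x /memS/(subsetP SJ); rewrite inE.
Qed.

Lemma heffter_row_family s k J A (wr : 'I_m -> seq 'Z_v) :
    relative_heffter s k J A -> ((n * k).*2 <= #|~: J|)%N ->
    (forall i, perm_eq (wr i) (row_elems A i) /\ simple_ordering (wr i)) ->
  difference_family s J wr.
Proof.
move=> hA leJ hw; have [A_inj A_opp A_notin] := heffter_entries hA leJ.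
have wP i x : reflect (exists j, A i j = Some x) (x \in wr i).
  by have [/perm_mem-> _] := hw i; apply: mem_row_elems.
split.
- by move=> i; have [/perm_size-> _] := hw i; apply: heffter_row_size hA i.
- move=> i; have [/(perm_big _) E _] := hw i; rewrite E; exact: heffter_row_sum hA i.
- by move=> i; have [] := hw i.
- move=> i; have [/perm_uniq-> _] := hw i.
  (* Wrapping the entries in [Some] turns [pmap] into a [map] over the filled positions of the row,
     on which the array is injective. *)
  rewrite -(map_inj_uniq (@Some_inj _)) pmapS_filter map_inj_in_uniq.
    by rewrite filter_uniq // enum_uniq.
  move=> j j'; rewrite !mem_filter => /andP[+ _] _.
  case Aij: (A i j) => [x|//] _ Aij'.
  by have [] := A_inj _ _ _ _ _ Aij (esym Aij').
- by move=> i i' x /wP[j Aij] /wP[j' Aij']; have [] := A_inj _ _ _ _ _ Aij Aij'.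
- by move=> i i' x /wP[j Aij]; apply/negP=> /wP[j' /(A_opp _ _ _ _ _ Aij)].
- by move=> i x /wP[j /A_notin].
- move=> x /(heffter_cover hA)[i [j [] Aij]]; exists i; [left|right];
    by apply/wP; exists j.
Qed.

End HeffterArrays.

Lemma heffter_tr v m n s k (J : {set 'Z_v}) (A : 'M[option 'Z_v]_(m, n)) :
  relative_heffter s k J A -> relative_heffter k s J A^T.
Proof.
case=> szr szc cov sr sc; split=> [j|i|x /cov[i [j Aij]]|j|i].
- by rewrite row_elems_tr.
- by rewrite col_elems_tr.
- by exists j, i; rewrite mxE.
- by rewrite row_elems_tr.
- by rewrite col_elems_tr.
Qed.

Theorem proposition2p9 (m n s k t v : nat)
    (hm : (0 < m)%N) (hn : (0 < n)%N) (hs : (0 < s)%N) (hk : (0 < k)%N)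
    (ht : (0 < t)%N)
    (hv : v = (2 * n * k + t)%N) (htv : (t %| 2 * n * k)%N)
    (J : {group 'Z_v}) (hJ : #|J| = t)
    (A : 'M[option 'Z_v]_(m, n)) (hA : relative_heffter s k J A)
    (wr : 'I_m -> seq 'Z_v) (wc : 'I_n -> seq 'Z_v)
    (hw : simple_wrt A wr wc) :
  [/\ [/\ is_complete_multipartite ((2 * m * s + t) %/ t)%N t (coset_graph J),
          cycle_decomposition s (coset_graph J) (cycle_translates wr)
        & cyclic_decomposition (coset_graph J) (cycle_translates wr)],
      [/\ is_complete_multipartite ((2 * n * k + t) %/ t)%N t (coset_graph J),
          cycle_decomposition k (coset_graph J) (cycle_translates wc)
        & cyclic_decomposition (coset_graph J) (cycle_translates wc)]
    & orthogonal_decompositions (cycle_translates wr) (cycle_translates wc)].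
Proof.
have eq_card := heffter_card hA; have [hwr hwc] := hw.
have v_gt1 : (1 < v)%N by rewrite hv; nia.
have leJ : ((n * k).*2 <= #|~: J|)%N.
  by rewrite cardsCs setCK card_ord Zp_cast // hJ hv -addnn; lia.
have complete : is_complete_multipartite ((2 * n * k + t) %/ t)%N t (coset_graph J).
  by rewrite -hv -hJ; exact: coset_graph_complete.
have dfr := heffter_row_family hA leJ hwr.
have dfc : difference_family k J wc.
  (* The columns are the rows of the transpose, for which the bound reads [(m * s).*2]. *)
  apply: (heffter_row_family (heffter_tr hA)); first by rewrite eq_card.
  by move=> j; rewrite row_elems_tr.
have [A_inj A_opp _] := heffter_entries hA leJ.
have wrP i x : reflect (exists j, A i j = Some x) (x \in wr i).
  by have [/perm_mem-> _] := hwr i; apply: mem_row_elems.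
have wcP j x : reflect (exists i, A i j = Some x) (x \in wc j).
  by have [/perm_mem-> _] := hwc j; apply: mem_col_elems.
split; [split | split |].
- by rewrite -mulnA eq_card mulnA.
- exact: df_cycle_decomposition.
- exact: cycle_translates_cyclic.
- by [].
- exact: df_cycle_decomposition.
- exact: cycle_translates_cyclic.
apply: df_orthogonal dfr dfc _ _ => [i j x /wrP[j' Aij']|i j x x'].
  by apply/negP=> /wcP[i' /(A_opp _ _ _ _ _ Aij')].
(* A value found in row [i] and in column [j] occupies a single cell, which must be their
   intersection. *)
have at_ij y : y \in wr i -> y \in wc j -> A i j = Some y.
  move=> /wrP[j' Aij'] /wcP[i' Ai'j].
  by have [_ <-] := A_inj _ _ _ _ _ Aij' Ai'j.
by move=> xr xc x'r x'c; apply: Some_inj; rewrite -!at_ij.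
Qed.
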